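(* Let $X$ be a real algebraic set with normalization $X'$. If $\mathcal O(X)'$ is the ring of regular functions of a real algebraic set (i.e. $\mathcal O(X)'$ is isomorphic as an $\mathbb R$-algebra to $\mathcal O(Y)$ for some real algebraic set $Y$), then $\mathcal O(X)'$ is isomorphic to $\mathcal O(X')$.
   Context: A real algebraic set $X\subset\mathbb R^n$ is the set of common zeros in $\mathbb R^n$ of some polynomials; $\mathcal P(X)=\mathbb R[x_1,\dots,x_n]/\mathcal I(X)$, where $\mathcal I(X)$ is the ideal of polynomials vanishing on $X$. The ring of regular functions is $\mathcal O(X)=\mathcal S(X)^{-1}\mathcal P(X)$ with $\mathcal S(X)$ the set of $f\in\mathcal P(X)$ with no zero on $X$. $\mathcal K(X)$ is the total ring of fractions of $\mathcal P(X)$ (also that of $\mathcal O(X)$), and $\mathcal O(X)'$ is the integral closure of $\mathcal O(X)$ in $\mathcal K(X)$. The normalization $X'$ is the real algebraic set whose ring $\mathcal P(X')$ of polynomial functions is the integral closure of $\mathcal P(X)$ in $\mathcal K(X)$. *)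

(* Defs.v *)
From HB Require Import structures.
From mathcomp Require Import all_boot all_order all_algebra.
From mathcomp Require Import boolp classical_sets reals.
From mathcomp Require Import mpoly ring.

Set Implicit Arguments.
Unset Strict Implicit.
Unset Printing Implicit Defensive.

Import GRing.Theory.
Local Open Scope ring_scope.
Local Open Scope quotient_scope.

(* Commutative algebras, given by their structure morphism.  [comAlgType] is
   not used because it excludes the zero ring: the empty set is a real algebraic
   set and its rings of functions are zero. *)
HB.mixin Record hasAlgMap (R : pzRingType) A of GRing.ComPzRing A := {
  algmap : {rmorphism R -> A}
}.

#[short(type="comPzAlgType")]
HB.structure Definition ComPzAlgebra (R : pzRingType) :=
  {A of GRing.ComPzRing A & hasAlgMap R A}.

HB.mixin Record isAlgHom (R : pzRingType) (A B : comPzAlgType R) (f : A -> B) := {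
  alghom_algmap : forall c : R, f (algmap c) = algmap c
}.

HB.structure Definition AlgHom (R : pzRingType) (A B : comPzAlgType R) :=
  {f of @GRing.RMorphism A B f & isAlgHom R A B f}.

Notation "{ 'alghom' A -> B }" := (@AlgHom.type _ A%type B%type)
  (A at level 98, B at level 99, format "{ 'alghom'  A  ->  B }") : type_scope.

Definition alg_isomorphic (R : pzRingType) (A B : comPzAlgType R) : Prop :=
  exists f : {alghom A -> B}, bijective f.

Section Localization.
Variables (A : comPzRingType) (S : mulrClosed A).

Definition preloc : Type := (A * {s : A | s \in S})%type.
HB.instance Definition _ := Choice.on preloc.

Definition loc_rel (x y : preloc) : bool :=
  `[< exists2 u, u \in S & u * (x.1 * sval y.2) = u * (y.1 * sval x.2) >].

Lemma loc_rel_is_equiv : equiv_class_of loc_rel.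
Proof.
split=> [x|x y|y x z].
- by apply/asboolP; exists 1; rewrite ?rpred1.
- by apply/asboolP/asboolP => -[u uS e]; exists u.
move=> /asboolP[u uS e1] /asboolP[v vS e2]; apply/asboolP.
exists (u * v * sval y.2); first by rewrite !rpredM ?(svalP y.2).
transitivity (u * (x.1 * sval y.2) * (v * sval z.2)); first by ring.
rewrite e1; transitivity (v * (y.1 * sval z.2) * (u * sval x.2)); first by ring.
by rewrite e2; ring.
Qed.

Canonical loc_rel_equiv := EquivRelPack loc_rel_is_equiv.
Canonical loc_rel_encModRel := defaultEncModRel loc_rel.

Definition loc : Type := {eq_quot loc_rel}.
HB.instance Definition _ : EqQuotient preloc loc_rel loc := EqQuotient.on loc.
HB.instance Definition _ := Choice.on loc.

Definition frac (a : A) (s : {s : A | s \in S}) : loc := \pi_loc (a, s).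

Lemma frac_eq a s b t :
  frac a s = frac b t <->
  exists2 u, u \in S & u * (a * sval t) = u * (b * sval s).
Proof.
by split=> [/eqmodP/asboolP|e]; last exact/eqmodP/asboolP.
Qed.

Lemma fracE (x : loc) : exists a s, x = frac a s.
Proof. by exists (repr x).1, (repr x).2; rewrite /frac -surjective_pairing reprK. Qed.

Definition den1 : {s : A | s \in S} := exist _ 1 (rpred1 S).
Definition denM (s t : {s : A | s \in S}) : {s : A | s \in S} :=
  exist _ (sval s * sval t) (rpredM (svalP s) (svalP t)).

Definition loc_add (x y : loc) : loc :=
  let: (a, s) := repr x in let: (b, t) := repr y in
  frac (a * sval t + b * sval s) (denM s t).
Definition loc_opp (x : loc) : loc := let: (a, s) := repr x in frac (- a) s.
Definition loc_mul (x y : loc) : loc :=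
  let: (a, s) := repr x in let: (b, t) := repr y in frac (a * b) (denM s t).

Lemma repr_frac a s : exists b t, repr (frac a s) = (b, t) /\
  exists2 u, u \in S & u * (b * sval s) = u * (a * sval t).
Proof.
exists (repr (frac a s)).1, (repr (frac a s)).2; split; first exact: surjective_pairing.
by apply/frac_eq; rewrite /frac -surjective_pairing reprK.
Qed.

Lemma loc_addE a s b t :
  loc_add (frac a s) (frac b t) = frac (a * sval t + b * sval s) (denM s t).
Proof.
rewrite /loc_add; have [a' [s' [-> [u uS eu]]]] := repr_frac a s.
have [b' [t' [-> [v vS ev]]]] := repr_frac b t.
apply/frac_eq; exists (u * v) => /=; first exact: rpredM.
transitivity (v * sval t * sval t' * (u * (a' * sval s)) +
              u * sval s * sval s' * (v * (b' * sval t))); first by ring.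
by rewrite eu ev; ring.
Qed.

Lemma loc_oppE a s : loc_opp (frac a s) = frac (- a) s.
Proof.
rewrite /loc_opp; have [a' [s' [-> [u uS eu]]]] := repr_frac a s.
by apply/frac_eq; exists u; rewrite // !mulNr !mulrN eu.
Qed.

Lemma loc_mulE a s b t : loc_mul (frac a s) (frac b t) = frac (a * b) (denM s t).
Proof.
rewrite /loc_mul; have [a' [s' [-> [u uS eu]]]] := repr_frac a s.
have [b' [t' [-> [v vS ev]]]] := repr_frac b t.
apply/frac_eq; exists (u * v) => /=; first exact: rpredM.
transitivity ((u * (a' * sval s)) * (v * (b' * sval t))); first by ring.
by rewrite eu ev; ring.
Qed.

Lemma frac_eq1 a s b t : a * sval t = b * sval s -> frac a s = frac b t.
Proof. by move=> e; apply/frac_eq; exists 1; rewrite ?rpred1 ?e. Qed.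

Lemma loc_addA : associative loc_add.
Proof.
move=> x y z; have [a [s ->]] := fracE x; have [b [t ->]] := fracE y.
have [c [r ->]] := fracE z; rewrite !loc_addE; apply: frac_eq1 => /=; ring.
Qed.

Lemma loc_addC : commutative loc_add.
Proof.
move=> x y; have [a [s ->]] := fracE x; have [b [t ->]] := fracE y.
by rewrite !loc_addE; apply: frac_eq1 => /=; ring.
Qed.

Lemma loc_add0 : left_id (frac 0 den1) loc_add.
Proof.
by move=> x; have [a [s ->]] := fracE x; rewrite !loc_addE; apply: frac_eq1 => /=; ring.
Qed.

Lemma loc_addN : left_inverse (frac 0 den1) loc_opp loc_add.
Proof.
move=> x; have [a [s ->]] := fracE x.
by rewrite loc_oppE loc_addE; apply: frac_eq1 => /=; ring.
Qed.

HB.instance Definition _ :=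
  GRing.isZmodule.Build loc loc_addA loc_addC loc_add0 loc_addN.

Lemma loc_mulA : associative loc_mul.
Proof.
move=> x y z; have [a [s ->]] := fracE x; have [b [t ->]] := fracE y.
have [c [r ->]] := fracE z; rewrite !loc_mulE; apply: frac_eq1 => /=; ring.
Qed.

Lemma loc_mulC : commutative loc_mul.
Proof.
move=> x y; have [a [s ->]] := fracE x; have [b [t ->]] := fracE y.
by rewrite !loc_mulE; apply: frac_eq1 => /=; ring.
Qed.

Lemma loc_mul1 : left_id (frac 1 den1) loc_mul.
Proof.
by move=> x; have [a [s ->]] := fracE x; rewrite !loc_mulE; apply: frac_eq1 => /=; ring.
Qed.

Lemma loc_mulDl : left_distributive loc_mul +%R.
Proof.
move=> x y z; have [a [s ->]] := fracE x; have [b [t ->]] := fracE y.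
have [c [r ->]] := fracE z.
rewrite [frac a s + _]loc_addE !loc_mulE [RHS]loc_addE; apply: frac_eq1 => /=; ring.
Qed.

HB.instance Definition _ :=
  GRing.Zmodule_isComPzRing.Build loc loc_mulA loc_mulC loc_mul1 loc_mulDl.

Lemma frac_add a s b t :
  frac a s + frac b t = frac (a * sval t + b * sval s) (denM s t).
Proof. exact: loc_addE. Qed.

Lemma frac_opp a s : - frac a s = frac (- a) s.
Proof. exact: loc_oppE. Qed.

Lemma frac_mul a s b t : frac a s * frac b t = frac (a * b) (denM s t).
Proof. exact: loc_mulE. Qed.

Definition toloc (a : A) : loc := frac a den1.

Lemma toloc_is_zmod_morphism : zmod_morphism toloc.
Proof.
by move=> a b; rewrite /toloc frac_opp frac_add; apply: frac_eq1 => /=; ring.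
Qed.

Lemma toloc_is_monoid_morphism : monoid_morphism toloc.
Proof.
by split=> [//|a b]; rewrite /toloc frac_mul; apply: frac_eq1 => /=; ring.
Qed.

HB.instance Definition _ :=
  GRing.isZmodMorphism.Build A loc toloc toloc_is_zmod_morphism.
HB.instance Definition _ :=
  GRing.isMonoidMorphism.Build A loc toloc toloc_is_monoid_morphism.

End Localization.

HB.instance Definition _ (R : pzRingType) (A : comPzAlgType R) (S : mulrClosed A) :=
  hasAlgMap.Build R (loc S) (toloc S \o algmap : {rmorphism R -> loc S}).

Lemma toloc_algmap (R : pzRingType) (A : comPzAlgType R) (S : mulrClosed A) (c : R) :
  toloc S (algmap c) = algmap c.
Proof. by []. Qed.

HB.instance Definition _ (R : pzRingType) (A : comPzAlgType R) (S : mulrClosed A) :=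
  isAlgHom.Build R A (loc S) (toloc S) (@toloc_algmap R A S).

Section LocalizationMap.
Variables (R : pzRingType) (A : comPzAlgType R) (S T : mulrClosed A).
Hypothesis ST : {subset S <= T}.

Definition loc_map (x : loc S) : loc T :=
  frac (repr x).1 (exist _ (sval (repr x).2) (ST (svalP (repr x).2))).

Lemma loc_mapE a (s : {s : A | s \in S}) :
  loc_map (frac a s) = frac a (exist _ (sval s) (ST (svalP s))).
Proof.
rewrite /loc_map; have [a' [s' [-> [u uS eu]]]] := repr_frac a s.
by apply/frac_eq; exists u; first exact: ST.
Qed.

Lemma loc_map_is_zmod_morphism : zmod_morphism loc_map.
Proof.
move=> x y; have [a [s ->]] := fracE x; have [b [t ->]] := fracE y.
rewrite [- frac b t]frac_opp [_ + _]frac_add !loc_mapE.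
by rewrite [- frac b _ in RHS]frac_opp [RHS]frac_add; apply: frac_eq1.
Qed.

Lemma loc_map_is_monoid_morphism : monoid_morphism loc_map.
Proof.
split=> [|x y]; first by rewrite [1 in LHS]/(frac _ _) loc_mapE; apply: frac_eq1.
have [a [s ->]] := fracE x; have [b [t ->]] := fracE y.
by rewrite [_ * _]frac_mul !loc_mapE [RHS]frac_mul; apply: frac_eq1.
Qed.

HB.instance Definition _ :=
  GRing.isZmodMorphism.Build (loc S) (loc T) loc_map loc_map_is_zmod_morphism.
HB.instance Definition _ :=
  GRing.isMonoidMorphism.Build (loc S) (loc T) loc_map loc_map_is_monoid_morphism.

Lemma loc_map_algmap (c : R) : loc_map (algmap c) = algmap c.
Proof. by rewrite /algmap /= /toloc loc_mapE; apply: frac_eq1. Qed.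

HB.instance Definition _ := isAlgHom.Build R (loc S) (loc T) loc_map loc_map_algmap.

End LocalizationMap.

Section TotalFractions.
Variable A : comPzRingType.

Definition nzdiv : {pred A} := fun a => `[< GRing.lreg a >].

Lemma nzdiv_mulr_closed : mulr_closed nzdiv.
Proof.
split=> [|a b /asboolP aP /asboolP bP]; apply/asboolP; first exact: lreg1.
exact: lregM.
Qed.

HB.instance Definition _ := GRing.isMulClosed.Build A nzdiv nzdiv_mulr_closed.

End TotalFractions.

Arguments nzdiv A : clear implicits.

(* In a commutative ring [GRing.lreg a] says that [a] is not a zero divisor. *)
Definition total_frac (R : pzRingType) (A : comPzAlgType R) : comPzAlgType R :=
  loc (nzdiv A).

Section IntegralClosure.
Variables (A B : comPzRingType) (f : {rmorphism A -> B}).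

(* [mxpoly.integralOver] needs nonzero rings. *)
Definition integral_over (b : B) : Prop :=
  exists n (c : 'I_n -> A), b ^+ n + \sum_(i < n) f (c i) * b ^+ i = 0.

Definition integral_pred : {pred B} := fun b => `[< integral_over b >].

End IntegralClosure.

(* When [B] is not zero, this is the library notion. *)
Lemma integral_overE (A B : comNzRingType) (f : {rmorphism A -> B}) (b : B) :
  integral_over f b <-> integralOver f b.
Proof.
split=> [[n [c e]]|[p pm /rootP e]].
  pose q : {poly A} := \poly_(i < n) (if insub i is Some j then c j else 0).
  have sq : (size q < size ('X^n : {poly A}))%N by rewrite size_polyXn ltnS size_poly.
  exists ('X^n + q); first by rewrite monicE lead_coefDl // lead_coefXn.
  rewrite rootE rmorphD /= map_polyXn !hornerE -[eqbRHS]e; apply/eqP; congr (_ + _).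
  rewrite (@horner_coef_wide _ n); last first.
    by rewrite (leq_trans (size_poly _ _)) // size_poly.
  apply: eq_bigr => i _; rewrite coef_map coef_poly ltn_ord; congr (f _ * _).
  by rewrite valK.
exists (size p).-1, (fun i => p`_i); rewrite -[RHS]e.
have sp : size p = (size p).-1.+1.
  by rewrite prednK // lt0n size_poly_eq0 monic_neq0.
rewrite (@horner_coef_wide _ (size p)) ?size_poly // [in RHS]sp big_ord_recr /=.
rewrite addrC coef_map /=; congr (_ + _).
  by move: pm; rewrite monicE lead_coefE => /eqP ->; rewrite rmorph1 mul1r.
by apply: eq_bigr => i _; rewrite coef_map.
Qed.

Lemma integral_pred_subring_closed (A B : comPzRingType) (f : {rmorphism A -> B}) :
  subring_closed (integral_pred f).
Proof.
have [B0|Bn0] := eqVneq (1 : B) 0.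
  have h b : b \in integral_pred f.
    apply/asboolP; exists 0%N, (fun _ => 0).
    by rewrite big_ord0 addr0 expr0.
  by split=> [|x y _ _|x y _ _]; exact: h.
have An0 : (1 : A) != 0.
  by apply: contraNneq Bn0 => e; rewrite -(rmorph1 f) e rmorph0.
pose B' : comNzRingType := HB.pack (GRing.ComPzRing.sort B)
  (GRing.PzSemiRing_isNonZero.Build B Bn0).
pose A' : comNzRingType := HB.pack (GRing.ComPzRing.sort A)
  (GRing.PzSemiRing_isNonZero.Build A An0).
pose f' : {rmorphism A' -> B'} := f.
have E (b : B) : integral_over f b <-> integralOver f' b := integral_overE f' b.
split=> [|x y /asboolP/E xi /asboolP/E yi|x y /asboolP/E xi /asboolP/E yi].
- exact/asboolP/E/integral1.
- exact/asboolP/E/(integral_sub xi yi).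
- exact/asboolP/E/(integral_mul xi yi).
Qed.

(* The integral closure in [B] of (the image under [f] of) [A]. *)
Section IntegralClosureType.
Variables (R : pzRingType) (A B : comPzAlgType R) (f : {alghom A -> B}).

Definition integral_closure : Type := {b : B | b \in integral_pred f}.

HB.instance Definition _ :=
  [isSub of integral_closure for (@proj1_sig _ _ : integral_closure -> B)].
HB.instance Definition _ := [Choice of integral_closure by <:].
HB.instance Definition _ := GRing.SubChoice_isSubComPzRing.Build
  B (integral_pred f) integral_closure (integral_pred_subring_closed f).

Lemma algmap_integral (c : R) : algmap c \in integral_pred f.
Proof.
apply/asboolP; exists 1%N, (fun _ => - algmap c).
by rewrite big_ord1 expr1 expr0 mulr1 rmorphN /= alghom_algmap subrr.
Qed.

Definition integral_algmap (c : R) : integral_closure :=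
  exist _ (algmap c) (algmap_integral c).

Lemma integral_algmap_is_zmod_morphism : zmod_morphism integral_algmap.
Proof. by move=> c d; apply: val_inj; rewrite /= rmorphB. Qed.

Lemma integral_algmap_is_monoid_morphism : monoid_morphism integral_algmap.
Proof. by split=> [|c d]; apply: val_inj; rewrite /= ?rmorph1 ?rmorphM. Qed.

HB.instance Definition _ := GRing.isZmodMorphism.Build
  R integral_closure integral_algmap integral_algmap_is_zmod_morphism.
HB.instance Definition _ := GRing.isMonoidMorphism.Build
  R integral_closure integral_algmap integral_algmap_is_monoid_morphism.
HB.instance Definition _ := hasAlgMap.Build R integral_closure
  (integral_algmap : {rmorphism R -> integral_closure}).

End IntegralClosureType.

Section RealAlgebraicSets.
Variables (R : realType) (n : nat) (X : set ('I_n -> R)).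

Definition real_algebraic_set : Prop :=
  exists P : set {mpoly R[n]}, X = [set x | forall p, P p -> p.@[x] = 0]%classic.

Definition vanishing_ideal : {pred {mpoly R[n]}} :=
  fun p => `[< forall x, X x -> p.@[x] = 0 >].

Lemma vanishing_ideal_zmod_closed : zmod_closed vanishing_ideal.
Proof.
split=> [|p q /asboolP pX /asboolP qX]; apply/asboolP => x xX.
  by rewrite meval0.
by rewrite mevalB pX // qX // subrr.
Qed.

HB.instance Definition _ := GRing.isZmodClosed.Build
  {mpoly R[n]} vanishing_ideal vanishing_ideal_zmod_closed.

Lemma vanishing_idealM p q : q \in vanishing_ideal -> p * q \in vanishing_ideal.
Proof.
by move=> /asboolP qX; apply/asboolP => x xX; rewrite mevalM qX // mulr0.
Qed.

(* [Quotient.quot] is the library quotient behind [{ideal_quot _}], which has a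
   ring structure only for proper ideals, that is, when [X] is not empty. *)
Definition polyfun : Type := Quotient.quot vanishing_ideal.
HB.instance Definition _ := GRing.Zmodule.on polyfun.
HB.instance Definition _ := EqQuotient.on polyfun.

Definition to_polyfun (p : {mpoly R[n]}) : polyfun := \pi_polyfun p.

Lemma to_polyfun_eq (p q : {mpoly R[n]}) :
  to_polyfun p = to_polyfun q <-> forall x, X x -> p.@[x] = q.@[x].
Proof.
split=> [/eqP|e].
  rewrite -[_ == _]/(p == q %[mod Quotient.quot vanishing_ideal]).
  rewrite -Quotient.idealrBE => /asboolP e x xX.
  by apply/eqP; rewrite -subr_eq0 -mevalB e.
apply/eqP; rewrite -[_ == _]/(p == q %[mod Quotient.quot vanishing_ideal]).
rewrite -Quotient.idealrBE; apply/asboolP => x xX.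
by rewrite mevalB e // subrr.
Qed.

Lemma to_polyfun_repr (f : polyfun) : to_polyfun (repr f) = f.
Proof. exact: reprK. Qed.

Lemma repr_polyfun (p : {mpoly R[n]}) x :
  X x -> (repr (to_polyfun p)).@[x] = p.@[x].
Proof. by move: x; apply/to_polyfun_eq; rewrite to_polyfun_repr. Qed.

Lemma to_polyfun_is_zmod_morphism : zmod_morphism to_polyfun.
Proof. by move=> p q; rewrite /to_polyfun Quotient.pi_add Quotient.pi_opp. Qed.

HB.instance Definition _ := GRing.isZmodMorphism.Build
  {mpoly R[n]} polyfun to_polyfun to_polyfun_is_zmod_morphism.

Definition polyfun_mul (f g : polyfun) : polyfun := to_polyfun (repr f * repr g).

Lemma polyfun_mulE p q :
  polyfun_mul (to_polyfun p) (to_polyfun q) = to_polyfun (p * q).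
Proof. by apply/to_polyfun_eq => x xX; rewrite !mevalM !repr_polyfun. Qed.

Lemma polyfun_mulA : associative polyfun_mul.
Proof.
move=> f g h; rewrite -[f]to_polyfun_repr -[g]to_polyfun_repr -[h]to_polyfun_repr.
by rewrite !polyfun_mulE mulrA.
Qed.

Lemma polyfun_mulC : commutative polyfun_mul.
Proof. by move=> f g; rewrite /polyfun_mul mulrC. Qed.

Lemma polyfun_mul1 : left_id (to_polyfun 1) polyfun_mul.
Proof. by move=> f; rewrite -[f]to_polyfun_repr polyfun_mulE mul1r. Qed.

Lemma polyfun_mulDl : left_distributive polyfun_mul +%R.
Proof.
move=> f g h; rewrite -[f]to_polyfun_repr -[g]to_polyfun_repr -[h]to_polyfun_repr.
have D p q : to_polyfun (p + q) = to_polyfun p + to_polyfun q by exact: raddfD.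
by rewrite -D !polyfun_mulE mulrDl D.
Qed.

HB.instance Definition _ := GRing.Zmodule_isComPzRing.Build
  polyfun polyfun_mulA polyfun_mulC polyfun_mul1 polyfun_mulDl.

Lemma to_polyfun_is_monoid_morphism : monoid_morphism to_polyfun.
Proof. by split=> // p q; rewrite -polyfun_mulE. Qed.

HB.instance Definition _ := GRing.isMonoidMorphism.Build
  {mpoly R[n]} polyfun to_polyfun to_polyfun_is_monoid_morphism.

HB.instance Definition _ := hasAlgMap.Build R polyfun
  (to_polyfun \o mpolyC n (R := R) : {rmorphism R -> polyfun}).

(* The value of [f] at a point [x] of [X]; see [repr_polyfun]. *)
Definition polyfun_eval (f : polyfun) (x : 'I_n -> R) : R := (repr f).@[x].

Lemma polyfun_eval1 x : X x -> polyfun_eval 1 x = 1.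
Proof. by move=> xX; rewrite /polyfun_eval repr_polyfun // meval1. Qed.

Lemma polyfun_evalM f g x :
  X x -> polyfun_eval (f * g) x = polyfun_eval f x * polyfun_eval g x.
Proof. by move=> xX; rewrite /polyfun_eval repr_polyfun // mevalM. Qed.

Definition no_zero : {pred polyfun} :=
  fun f => `[< forall x, X x -> polyfun_eval f x != 0 >].

Lemma no_zero_mulr_closed : mulr_closed no_zero.
Proof.
split=> [|f g /asboolP f0 /asboolP g0]; apply/asboolP => x xX.
  by rewrite polyfun_eval1 // oner_neq0.
by rewrite polyfun_evalM // mulf_neq0 ?f0 ?g0.
Qed.

HB.instance Definition _ := GRing.isMulClosed.Build polyfun no_zero no_zero_mulr_closed.

Lemma no_zero_nzdiv : {subset no_zero <= nzdiv polyfun}.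
Proof.
move=> f /asboolP f0; apply/asboolP => g h.
rewrite -[g]to_polyfun_repr -[h]to_polyfun_repr => e.
apply/to_polyfun_eq => x xX; apply: (mulfI (f0 x xX)).
by rewrite -[LHS]mevalM -[RHS]mevalM; move: x xX; apply/to_polyfun_eq;
  rewrite !rmorphM /= !to_polyfun_repr; move: e; rewrite !to_polyfun_repr.
Qed.

Definition regfun : comPzAlgType R := loc no_zero.

Definition ratfun : comPzAlgType R := total_frac polyfun.

Definition polyfun_to_ratfun : {alghom polyfun -> ratfun} := toloc (nzdiv polyfun).

Definition regfun_to_ratfun : {alghom regfun -> ratfun} := loc_map no_zero_nzdiv.

Definition polyfun_closure : comPzAlgType R := integral_closure polyfun_to_ratfun.

Definition regfun_closure : comPzAlgType R := integral_closure regfun_to_ratfun.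

End RealAlgebraicSets.

Definition is_normalization (R : realType) (n m : nat)
    (X : set ('I_n -> R)) (X' : set ('I_m -> R)) : Prop :=
  real_algebraic_set X' /\ alg_isomorphic (polyfun X') (polyfun_closure X).

(* Main.v *)
From HB Require Import structures.
From mathcomp Require Import all_boot all_order all_algebra.
From mathcomp Require Import boolp classical_sets reals.
From mathcomp Require Import mpoly.
Require Import Defs.

(** Write [P] and [O] for the rings of polynomial and of regular functions, and
    [P(X)'], [O(X)'] for their integral closures in the ring of rational
    functions, so that [P(X') = P(X)'].  Let [S] and [S'] be the sets of
    elements of [P(X)] and [P(X')] without zeros.

    Real points and characters correspond: the ring morphisms [P(X) -> R] that
    fix the constants are the evaluations at the points of [X]
    ([polyfun_character]).  So an element of [P(X')] lies in [S'] exactly when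
    no character kills it, which gives two inclusions.

    - [S] is sent into [S'], because a character of [P(X')] restricts to a
      character of [P(X)].
    - [S'] consists of units of [O(X)'].  In a ring of regular functions, an
      element that no character kills is invertible ([regfun_invertible]);
      this is a property of the algebra alone, so it holds in [O(X)'] as soon
      as [O(X)'] is isomorphic to some [O(Y)].  And a character of [O(X)']
      restricts to a character of [P(X')], which does not kill an element of
      [S'].

    Integral closure commutes with localization: clearing the denominators of
    an integral equation shows that every [b] in [O(X)'] satisfies [s b] in
    [P(X)'] for some [s] in [S] ([integral_clear_denominator]).  Thus [O(X)']
    contains [P(X')], inverts [S'], and consists of fractions of elements of
    [P(X')] with denominators in [S']: it is the localization of [P(X')] at
    [S'] ([loc_isomorphic]), that is, [O(X')]. *)

Set Implicit Arguments.
Unset Strict Implicit.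
Unset Printing Implicit Defensive.

Import GRing.Theory.
Local Open Scope ring_scope.

(** * Algebra morphisms *)

Lemma invertible_lreg (A : comPzRingType) (a u : A) : a * u = 1 -> GRing.lreg a.
Proof.
by move=> au; apply: (can_inj (g := *%R u)) => x; rewrite mulrA [u * a]mulrC au mul1r.
Qed.

Section AlgHomTheory.
Variable R : pzRingType.

Section Comp.
Variables (A B C : comPzAlgType R) (g : {alghom B -> C}) (f : {alghom A -> B}).

Lemma comp_algmap c : (g \o f) (algmap c) = algmap c.
Proof. by rewrite /= !alghom_algmap. Qed.

HB.instance Definition _ := isAlgHom.Build R A C (g \o f) comp_algmap.

End Comp.

Lemma alghom_inverse (A B : comPzAlgType R) (f : {alghom A -> B}) :
  bijective f -> exists g : {alghom B -> A}, cancel f g /\ cancel g f.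
Proof.
case=> g fK gK.
pose g' : {alghom B -> A} := HB.pack g
  (GRing.isZmodMorphism.Build B A g (can2_zmod_morphism fK gK))
  (GRing.isMonoidMorphism.Build B A g (can2_monoid_morphism fK gK))
  (isAlgHom.Build R B A g (fun c => canLR fK (esym (alghom_algmap c)))).
by exists g'.
Qed.

Lemma alg_isomorphic_sym (A B : comPzAlgType R) :
  alg_isomorphic A B -> alg_isomorphic B A.
Proof. by case=> f /alghom_inverse[g [fK gK]]; exists g; exists f. Qed.

End AlgHomTheory.

(** * The universal property of localization *)

Section LocalizationLift.
Variables (A B : comPzRingType) (S : mulrClosed A) (h : {rmorphism A -> B}).
Hypothesis hU : forall s, s \in S -> exists u, h s * u = 1.

(** A value at [a / s] is computed from the representative of the quotient class
    and a chosen inverse of the image of its denominator; [loc_liftK] says that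
    the result solves [h s * z = h a] for every representative. *)
Definition loc_lift (x : loc S) : B :=
  h (repr x).1 * sval (cid (hU (svalP (repr x).2))).

Lemma denom_lreg (s : {s : A | s \in S}) : GRing.lreg (h (sval s)).
Proof. by have [u /invertible_lreg] := hU (svalP s). Qed.

Lemma loc_liftK a (s : {s : A | s \in S}) :
  h (sval s) * loc_lift (frac a s) = h a.
Proof.
rewrite /loc_lift; case: cid => u /=.
have [a' [s' [-> [v vS e]]]] := repr_frac a s => /= su.
apply: (@denom_lreg (exist _ v vS)) => /=.
have -> : h v * (h (sval s) * (h a' * u)) = h (v * (a' * sval s)) * u.
  by rewrite !rmorphM -!mulrA [h a' * (_ * _)]mulrCA.
by rewrite e -rmorphM /= mulrA rmorphM -mulrA su mulr1.
Qed.

Lemma loc_lift_eq x b a (s : {s : A | s \in S}) :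
  x = frac a s -> h (sval s) * b = h a -> loc_lift x = b.
Proof. by move=> -> e; apply: (@denom_lreg s); rewrite loc_liftK. Qed.

Lemma loc_lift_is_zmod_morphism : zmod_morphism loc_lift.
Proof.
move=> x y; have [a [s ->]] := fracE x; have [b [t ->]] := fracE y.
rewrite [- frac b t]frac_opp [_ + _]frac_add; apply: loc_lift_eq => //=.
rewrite rmorphM rmorphD !rmorphM rmorphN mulrBr.
by rewrite mulrAC loc_liftK -mulrA loc_liftK mulNr [h (sval s) * _]mulrC.
Qed.

Lemma loc_lift_is_monoid_morphism : monoid_morphism loc_lift.
Proof.
split=> [|x y].
  by apply: (@loc_lift_eq _ _ 1 (den1 S)); rewrite //= mulr1.
have [a [s ->]] := fracE x; have [b [t ->]] := fracE y.
rewrite [_ * _]frac_mul; apply: loc_lift_eq => //=.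
by rewrite !rmorphM mulrACA !loc_liftK.
Qed.

HB.instance Definition _ :=
  GRing.isZmodMorphism.Build (loc S) B loc_lift loc_lift_is_zmod_morphism.
HB.instance Definition _ :=
  GRing.isMonoidMorphism.Build (loc S) B loc_lift loc_lift_is_monoid_morphism.

Lemma loc_lift_toloc a : loc_lift (toloc S a) = h a.
Proof. by apply: loc_lift_eq; rewrite //= rmorph1 mul1r. Qed.

End LocalizationLift.

(** These conditions characterize localization: the morphism induced by [h] is
    onto because every [b] is a fraction, and one-to-one because an equality of
    images can be cross-multiplied into an equality in the image of [A], where
    [h] is injective. *)
Lemma loc_isomorphic (R : pzRingType) (A B : comPzAlgType R) (S : mulrClosed A)
    (h : {alghom A -> B}) :
  injective h ->
  (forall s, s \in S -> exists u, h s * u = 1) ->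
  (forall b, exists a s, s \in S /\ h s * b = h a) ->
  alg_isomorphic (loc S) B.
Proof.
move=> h_inj hU h_frac.
have liftA c : loc_lift hU (algmap c) = algmap c.
  exact: etrans (loc_lift_toloc hU _) (alghom_algmap c).
pose H : {alghom loc S -> B} := HB.pack (loc_lift hU)
  (GRing.RMorphism.on (loc_lift hU)) (isAlgHom.Build R (loc S) B _ liftA).
exists H; have frac_of b : exists p : A * {s : A | s \in S}, h (sval p.2) * b = h p.1.
  by have [a [s [sS e]]] := h_frac b; exists (a, exist _ s sS).
have [F FE] := boolp.choice frac_of.
have HK b : H (frac (F b).1 (F b).2) = b by exact: loc_lift_eq (FE b).
exists (fun b => frac (F b).1 (F b).2) => // x.
have [a [s ->]] := fracE x; apply: frac_eq1; apply: h_inj.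
set y := H _; have hy : h (sval s) * y = h a by exact: loc_liftK.
by rewrite !rmorphM /= -FE -hy mulrAC -mulrA mulrC.
Qed.

(** * Integral closures and denominators *)

Section ClosureMap.
Variables (R : pzRingType) (A B C : comPzAlgType R).
Variables (f : {alghom A -> C}) (g : {alghom B -> C}) (k : {alghom A -> B}).
Hypothesis gk : g \o k =1 f.

Lemma integral_pred_sub : {subset integral_pred f <= integral_pred g}.
Proof.
move=> b /asboolP[n [c e]]; apply/asboolP; exists n, (k \o c).
rewrite -[RHS]e; congr (_ + _); apply: eq_bigr => i _.
by congr (_ * _); exact: gk.
Qed.

Definition closure_map (b : integral_closure f) : integral_closure g :=
  exist _ (val b) (integral_pred_sub (valP b)).

Lemma closure_map_is_zmod_morphism : zmod_morphism closure_map.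
Proof. by move=> x y; exact: val_inj. Qed.

Lemma closure_map_is_monoid_morphism : monoid_morphism closure_map.
Proof. by split=> [|x y]; exact: val_inj. Qed.

Lemma closure_map_algmap c : closure_map (algmap c) = algmap c.
Proof. exact: val_inj. Qed.

HB.instance Definition _ := GRing.isZmodMorphism.Build
  (integral_closure f) (integral_closure g) closure_map closure_map_is_zmod_morphism.
HB.instance Definition _ := GRing.isMonoidMorphism.Build
  (integral_closure f) (integral_closure g) closure_map closure_map_is_monoid_morphism.
HB.instance Definition _ := isAlgHom.Build R
  (integral_closure f) (integral_closure g) closure_map closure_map_algmap.

Lemma closure_map_inj : injective closure_map.
Proof. by move=> x y [e]; apply: val_inj. Qed.

End ClosureMap.

Section ToClosure.
Variables (R : pzRingType) (A B : comPzAlgType R) (f : {alghom A -> B}).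

Lemma integral_image a : f a \in integral_pred f.
Proof.
apply/asboolP; exists 1%N, (fun=> - a).
by rewrite big_ord1 expr1 expr0 mulr1 rmorphN subrr.
Qed.

Definition to_closure (a : A) : integral_closure f := exist _ (f a) (integral_image a).

Lemma to_closure_is_zmod_morphism : zmod_morphism to_closure.
Proof. by move=> x y; apply: val_inj; rewrite /= !rmorphB. Qed.

Lemma to_closure_is_monoid_morphism : monoid_morphism to_closure.
Proof. by split=> [|x y]; apply: val_inj; rewrite /= ?rmorph1 ?rmorphM. Qed.

Lemma to_closure_algmap c : to_closure (algmap c) = algmap c.
Proof. by apply: val_inj; rewrite /= alghom_algmap. Qed.

HB.instance Definition _ := GRing.isZmodMorphism.Build
  A (integral_closure f) to_closure to_closure_is_zmod_morphism.
HB.instance Definition _ := GRing.isMonoidMorphism.Build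
  A (integral_closure f) to_closure to_closure_is_monoid_morphism.
HB.instance Definition _ := isAlgHom.Build R
  A (integral_closure f) to_closure to_closure_algmap.

End ToClosure.

Lemma common_denominator (A : comPzRingType) (S : mulrClosed A) n (c : 'I_n -> loc S) :
  exists2 s, s \in S & exists a, forall i, toloc S s * c i = toloc S (a i).
Proof.
have fracP i : exists p : A * {s : A | s \in S}, c i = frac p.1 p.2.
  by have [a [s ->]] := fracE (c i); exists (a, s).
have [p cE] := boolp.choice fracP.
exists (\prod_i sval (p i).2); first by apply: rpred_prod => i _; exact: svalP (p i).2.
exists (fun i => (\prod_(j | j != i) sval (p j).2) * (p i).1) => i.
rewrite cE [_ * _]frac_mul; apply: frac_eq1 => /=.
by rewrite (bigD1 i) //= mulr1 mul1r -[LHS]mulrA mulrC.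
Qed.

(** Multiplying a monic equation of degree [n] in [b] by [s ^+ n] gives a monic
    equation in [s * b].  The term of degree [i < n] has at least one factor [s]
    to spare, which is what turns the coefficient [c] into [s * c], free of
    denominators. *)
Lemma clear_denominator_term (B : comPzRingType) (s c b : B) n i :
  (i < n)%N -> s ^+ (n - i.+1) * (s * c) * (s * b) ^+ i = s ^+ n * (c * b ^+ i).
Proof.
move=> lt_in; rewrite -[in RHS](subnK lt_in) exprMn addnS -addSn exprD exprSr.
by rewrite -!mulrA; congr (_ * (_ * _)); rewrite mulrCA.
Qed.

Lemma integral_clear_denominator (R : pzRingType) (A : comPzAlgType R)
    (S T : mulrClosed A) (ST : {subset S <= T}) (b : loc T) :
  integral_over (loc_map ST) b ->
  exists2 s, s \in S & integral_over (toloc T) (toloc T s * b).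
Proof.
move=> [n [c e]]; have [s sS [a aE]] := common_denominator c.
have mapE x : loc_map ST (toloc S x) = toloc T x.
  by rewrite loc_mapE; exact: frac_eq1.
exists s => //; exists n, (fun i : 'I_n => s ^+ (n - i.+1) * a i).
rewrite -[RHS](mulr0 (toloc T s ^+ n)) -[in RHS]e mulrDr exprMn mulr_sumr.
congr (_ + _); apply: eq_bigr => i _.
rewrite -[RHS]clear_denominator_term // rmorphM rmorphXn; congr (_ * _ * _).
by rewrite /= -mapE -aE rmorphM /= mapE.
Qed.

(** * Points as characters *)

Section Points.
Variables (R : realType) (n : nat) (X : set ('I_n -> R)).

Section EvalAt.
Variables (x : 'I_n -> R) (xX : X x).

Lemma polyfun_eval_is_zmod_morphism :
  zmod_morphism (fun f : polyfun X => polyfun_eval f x).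
Proof.
move=> f g; rewrite -[f]to_polyfun_repr -[g]to_polyfun_repr -rmorphB.
by rewrite /polyfun_eval !repr_polyfun // mevalB.
Qed.

Lemma polyfun_eval_is_monoid_morphism :
  monoid_morphism (fun f : polyfun X => polyfun_eval f x).
Proof. by split=> [|f g]; [exact: polyfun_eval1|exact: polyfun_evalM]. Qed.

Definition eval_at : {rmorphism polyfun X -> R} := HB.pack
  (fun f : polyfun X => polyfun_eval f x)
  (GRing.isZmodMorphism.Build (polyfun X) R _ polyfun_eval_is_zmod_morphism)
  (GRing.isMonoidMorphism.Build (polyfun X) R _ polyfun_eval_is_monoid_morphism).

Lemma eval_at_algmap : cancel algmap eval_at.
Proof. by move=> c; rewrite /= /polyfun_eval repr_polyfun // mevalC. Qed.

End EvalAt.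

(** The point is the tuple of values of [phi] at the coordinate functions.  It
    lies on [X] because [X] contains all common zeros of its equations, and
    [phi] sends each equation, which is zero in [polyfun X], to [0]. *)
Lemma polyfun_character (phi : {rmorphism polyfun X -> R}) :
  real_algebraic_set X -> cancel algmap phi ->
  exists2 x, X x & forall f, phi f = polyfun_eval f x.
Proof.
move=> [P XE] phiK; pose x i := phi (to_polyfun X 'X_i).
have phiE p : phi (to_polyfun X p) = p.@[x].
  rewrite {1}[p]mpolyE mevalE !rmorph_sum; apply: eq_bigr => m _.
  rewrite -mul_mpolyC !rmorphM /= [phi _]phiK; congr (_ * _).
  by rewrite mpolyXE_id !rmorph_prod; apply: eq_bigr => i _; rewrite !rmorphXn.
exists x; last by move=> f; rewrite -{1}[f]to_polyfun_repr phiE.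
rewrite XE => p Pp; rewrite -phiE -(rmorph0 phi) -(rmorph0 (to_polyfun X)).
congr (phi _); apply/to_polyfun_eq => y; rewrite {1}XE => yP.
by rewrite yP // meval0.
Qed.

Lemma no_zero_character (f : polyfun X) (phi : {rmorphism polyfun X -> R}) :
  real_algebraic_set X -> f \in @no_zero R n X -> cancel algmap phi -> phi f != 0.
Proof.
move=> algX /asboolP f0 phiK.
by have [x xX ->] := polyfun_character algX phiK; exact: f0.
Qed.

(** Evaluations at the points of [X] extend to regular functions, so the numerator
    of such an [f] has no zero on [X] and may serve as a denominator.  The
    hypothesis mentions only the algebra structure of [regfun X], hence can be
    checked on any isomorphic algebra. *)
Lemma regfun_invertible (f : regfun X) :
  (forall phi : {rmorphism regfun X -> R}, cancel algmap phi -> phi f != 0) ->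
  exists u, f * u = 1.
Proof.
have [a [s ->]] := fracE f => f0.
have aS : a \in @no_zero R n X.
  apply/asboolP => x xX.
  have evU t : t \in @no_zero R n X -> exists u, eval_at xX t * u = 1.
    by move=> /asboolP t0; exists (eval_at xX t)^-1; rewrite divff // t0.
  have evK : cancel algmap (loc_lift evU).
    by move=> c; exact: etrans (loc_lift_toloc evU _) (eval_at_algmap xX c).
  have := f0 _ evK; apply: contraNneq => a0.
  by apply/eqP; apply: (loc_lift_eq evU) => //; rewrite mulr0; exact: esym a0.
exists (frac (sval s) (exist _ a aS)).
by rewrite [_ * _]frac_mul; apply: frac_eq1 => /=; rewrite mulr1 mul1r mulrC.
Qed.

End Points.

(** * Regular functions on the normalization *)

Theorem proposition3p3 (R : realType) (n m : nat)
    (X : set ('I_n -> R)) (X' : set ('I_m -> R)) :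
  real_algebraic_set X ->
  is_normalization X X' ->
  (exists (k : nat) (Y : set ('I_k -> R)),
     real_algebraic_set Y /\ alg_isomorphic (regfun_closure X) (regfun Y)) ->
  alg_isomorphic (regfun_closure X) (regfun X').
Proof.
move=> algX [algX' [f f_bij]] [k [Y [_ [psi psi_bij]]]].
have [g [fK gK]] := alghom_inverse f_bij.
have [psi' [psiK psi'K]] := alghom_inverse psi_bij.
have PO : regfun_to_ratfun X \o toloc (@no_zero R n X) =1 polyfun_to_ratfun X.
  by move=> p; rewrite /= loc_mapE; exact: frac_eq1.
pose j : {alghom polyfun_closure X -> regfun_closure X} := closure_map PO.
pose h : {alghom polyfun X' -> regfun_closure X} := j \o f.
apply: alg_isomorphic_sym; apply: (@loc_isomorphic _ _ _ _ h).
- by move=> p q /closure_map_inj /(can_inj fK).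
  (* Elements without zeros on [X'] become units, by way of [regfun Y]. *)
- move=> s s0; have [|u hu] := @regfun_invertible _ _ Y (psi (h s)).
    move=> phi phiK.
    apply: (no_zero_character (phi := phi \o (psi \o h)) algX' s0) => c.
    exact: etrans (congr1 phi (alghom_algmap (s := psi \o h) c)) (phiK c).
  exists (psi' u); apply: (can_inj psiK).
  by rewrite rmorphM /= psi'K hu rmorph1.
(* [b] is the fraction [(s * b) / s] with [s] without zeros on [X]; the element
   of [polyfun X'] that corresponds to [s] then has no zero on [X']. *)
move=> b; have /asboolP/integral_clear_denominator[s s0 sb_int] := valP b.
have sbP : toloc (nzdiv (polyfun X)) s * val b \in integral_pred (polyfun_to_ratfun X).
  exact/asboolP.
pose i : {alghom polyfun X -> polyfun_closure X} := to_closure (polyfun_to_ratfun X).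
pose sb : polyfun_closure X := exist (fun z => z \in integral_pred _) _ sbP.
exists (g sb), (g (i s)); split; last first.
  by apply: val_inj; rewrite /= !gK.
apply/asboolP => x xX.
apply: (no_zero_character (phi := eval_at xX \o (g \o i)) algX s0) => c.
exact: etrans (congr1 (eval_at xX) (alghom_algmap (s := g \o i) c)) (eval_at_algmap xX c).
Qed.
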